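(* 1. Every $K_{im}$-algebra (or $K_{im-\vee}$-algebra) $\mathcal{A}$ can be embedded into the complex algebra $Up(\mathcal{F}_{\mathcal{A}})$ of the canonical frame $\mathcal{F}_{\mathcal{A}}$ of $\mathcal{A}$. 2. Every sub-compatibility frame (or sub-compatibility identity frame) $\mathcal{F}$ can be embedded into the canonical frame $\mathcal{F}_{Up(\mathcal{F})}$ of the complex algebra $Up(\mathcal{F})$ of $\mathcal{F}$.
   Context: On a bounded distributive lattice $(A,1,0,\vee,\wedge)$, a unary operation $n$ is a preminimal negation if $a\leq b\Rightarrow nb\leq na$, $na\wedge nb\leq n(a\vee b)$ and $n0=1$; a minimal negation if moreover $a\leq nna$ and $a\wedge b\leq c\Rightarrow a\wedge nc\leq nb$; an intuitionistic negation if moreover $a\wedge na\leq b$ for all $a,b$. A $K_{im}$-algebra is $(A,1,0,\vee,\wedge,\neg,\sim)$ with $(A,1,0,\vee,\wedge)$ a bounded distributive lattice, $\neg$ an intuitionistic negation, $\sim$ a minimal negation, and $\neg\neg\sim1=\sim1$. A $K_{im-\vee}$-algebra is a $K_{im}$-algebra with $a\vee\sim a=1$ for all $a$. A compatibility frame is $(W,C,\leq)$ with $(W,\leq)$ a poset and $C$ a binary relation on $W$ such that $x'\leq x$, $y'\leq y$ and $xCy$ imply $x'Cy'$. A sub-compatibility frame is a compatibility frame such that (1) $C$ is symmetric; (2) $\forall x,y\,(xCy\Rightarrow\exists z(x\leq z\ \&\ y\leq z\ \&\ xCz))$; (3) for all $x$: if for every $y\geq x$ there is $z\geq y$ with no $z'$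 satisfying $zCz'$, then there is no $z''$ with $xCz''$. A sub-compatibility identity frame is a sub-compatibility frame in which $xCy$ implies $y\leq x$. The complex algebra of $\mathcal{F}=(W,C,\leq)$ is $Up(\mathcal{F})=(Up(W),W,\emptyset,\cup,\cap,\neg,\sim)$, where $Up(W)$ is the set of upsets of $W$, $\neg U=\{w:\forall v\in W\,(w\leq v\Rightarrow v\notin U)\}$ and $\sim U=\{w:\forall v\in W\,(wCv\Rightarrow v\notin U)\}$; for a sub-compatibility (identity) frame it is a $K_{im}$-algebra ($K_{im-\vee}$-algebra). The canonical frame of a $K_{im}$-algebra $\mathcal{A}$ is $\mathcal{F}_{\mathcal{A}}=(X_A,C,\subseteq)$, where $X_A$ is the set of prime filters of $\mathcal{A}$ and $PCQ$ iff for all $a\in A$, $\sim a\in P\Rightarrow a\notin Q$. An embedding of algebras is an order-preserving and order-reflecting map preserving all operations. An embedding of frames $(W,C,\leq)\to(W',C',\leq')$ is a map $f$ with $x\leq y\Leftrightarrow f(x)\leq'f(y)$ and $xCy\Leftrightarrow f(x)C'f(y)$ for all $x,y\in W$. *)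

(* Defs.v *)
From HB Require Import structures.
From mathcomp Require Import all_boot all_order.
From mathcomp Require Import boolp classical_sets.

Set Implicit Arguments.
Unset Strict Implicit.
Unset Printing Implicit Defensive.

Import Order.TTheory.
(* order_scope comes last: `&` and `|` are the lattice operations, which on sets
   are intersection and union. *)
Local Open Scope classical_set_scope.
Local Open Scope order_scope.

Section Negations.
Context {d : Order.disp_t} {A : tbDistrLatticeType d}.
Implicit Types (n : A -> A) (a b c : A).

Definition preminimal_negation n : Prop :=
  [/\ forall a b, a <= b -> n b <= n a,
      forall a b, n a `&` n b <= n (a `|` b)
    & n \bot = \top].

Definition minimal_negation n : Prop :=
  [/\ preminimal_negation n,
      forall a, a <= n (n a)
    & forall a b c, a `&` b <= c -> a `&` n c <= n b].

Definition intuitionistic_negation n : Prop :=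
  minimal_negation n /\ forall a b, a `&` n a <= b.

End Negations.

(* Neither structure excludes the one-element algebra, where \bot = \top. *)
HB.mixin Record isKim d A of Order.TBDistrLattice d A := {
  neg : A -> A;
  sim : A -> A;
  neg_intuitionistic : intuitionistic_negation neg;
  sim_minimal : minimal_negation sim;
  neg_neg_sim1 : neg (neg (sim \top)) = sim \top
}.

#[short(type="kimType")]
HB.structure Definition Kim d := { A of isKim d A & Order.TBDistrLattice d A }.

HB.mixin Record isKimOr d A of Kim d A := {
  joinxsim : forall a : A, a `|` sim a = \top
}.

#[short(type="kimOrType")]
HB.structure Definition KimOr d := { A of isKimOr d A & Kim d A }.

(* The poset W may be empty; this happens for the canonical frame of the
   one-element algebra. *)
HB.mixin Record isCompatFrame d W of Order.POrder d W := {
  compat : W -> W -> Prop;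
  compat_down : forall x x' y y' : W,
    x' <= x -> y' <= y -> compat x y -> compat x' y'
}.

#[short(type="compatFrameType")]
HB.structure Definition CompatFrame d :=
  { W of isCompatFrame d W & Order.POrder d W }.

HB.mixin Record isSubCompatFrame d W of CompatFrame d W := {
  compat_sym : forall x y : W, compat x y -> compat y x;
  compat_sup : forall x y : W, compat x y ->
    exists z : W, [/\ x <= z, y <= z & compat x z];
  compat_dense : forall x : W,
    (forall y : W, x <= y ->
       exists z : W, y <= z /\ ~ (exists z' : W, compat z z')) ->
    ~ (exists z'' : W, compat x z'')
}.

#[short(type="subCompatFrameType")]
HB.structure Definition SubCompatFrame d :=
  { W of isSubCompatFrame d W & CompatFrame d W }.

HB.mixin Record isSubCompatIdFrame d W of SubCompatFrame d W := {
  compat_ge : forall x y : W, compat x y -> y <= x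
}.

#[short(type="subCompatIdFrameType")]
HB.structure Definition SubCompatIdFrame d :=
  { W of isSubCompatIdFrame d W & SubCompatFrame d W }.

Definition kim_embedding d d' (A : kimType d) (B : kimType d') (f : A -> B) :
    Prop :=
  [/\ {mono f : a b / a <= b},
      f \top = \top /\ f \bot = \bot,
      {morph f : a b / a `|` b} /\ {morph f : a b / a `&` b},
      {morph f : a / neg a}
    & {morph f : a / sim a}].

Definition frame_embedding d d' (W : compatFrameType d)
    (W' : compatFrameType d') (f : W -> W') : Prop :=
  {mono f : x y / x <= y} /\ forall x y, compat x y <-> compat (f x) (f y).

(* Up W carries the complex algebra of the frame W: its lattice structure is
   inherited from set W, so that meet, join, bottom, top and order are
   intersection, union, set0, setT and inclusion. *)
Section UpsetLattice.
Context {d : Order.disp_t} (W : porderType d).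

Definition upset (U : set W) : Prop := forall x y, x <= y -> U x -> U y.

Definition is_upset : pred (set W) := fun U => `[< upset U >].

Record Up := MkUp { Up_set :> set W; _ : is_upset Up_set }.

HB.instance Definition _ := [isSub for Up_set].
HB.instance Definition _ := [Choice of Up by <:].

Fact is_upsetI : meet_closed is_upset.
Proof.
move=> U V /asboolP hU /asboolP hV; apply/asboolP => x y xy [Ux Vx].
by split; [apply: hU xy Ux | apply: hV xy Vx].
Qed.

Fact is_upsetU : join_closed is_upset.
Proof.
move=> U V /asboolP hU /asboolP hV; apply/asboolP => x y xy [Ux|Vx].
  by left; apply: hU xy Ux.
by right; apply: hV xy Vx.
Qed.

Fact is_upset0 : \bot \in is_upset.
Proof. by apply/asboolP. Qed.

Fact is_upsetT : \top \in is_upset.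
Proof. by apply/asboolP. Qed.

HB.instance Definition _ :=
  Order.SubChoice_isTBSubLattice.Build set_display (set W) is_upset
    set_display Up is_upsetI is_upsetU is_upset0 is_upsetT.

Lemma Up_setI (U V : Up) : Up_set (U `&` V) = Up_set U `&` Up_set V.
Proof. by []. Qed.

Lemma Up_setU (U V : Up) : Up_set (U `|` V) = Up_set U `|` Up_set V.
Proof. by []. Qed.

Lemma Up_set0 : Up_set \bot = set0.
Proof. by []. Qed.

Lemma Up_setT : Up_set \top = setT.
Proof. by []. Qed.

Fact Up_meetUl : @left_distributive Up Up Order.meet Order.join.
Proof.
move=> U V Z; apply: val_inj.
exact: (@meetUl _ (set W)).
Qed.

HB.instance Definition _ :=
  Order.Lattice_Meet_isDistrLattice.Build set_display Up Up_meetUl.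

Lemma UpP (U : Up) x y : x <= y -> Up_set U x -> Up_set U y.
Proof. by case: U => U /= /asboolP; apply. Qed.

Lemma Up_leP (U V : Up) : reflect (U `<=` V) (U <= V).
Proof. by exact: (@subsetPset _ (val U) (val V)). Qed.

End UpsetLattice.

Section ComplexAlgebra.
Context {d : Order.disp_t} (W : compatFrameType d).

Definition up_neg_set (U : set W) : set W :=
  [set w | forall v : W, w <= v -> ~ U v].

Definition up_sim_set (U : set W) : set W :=
  [set w | forall v : W, compat w v -> ~ U v].

Fact up_neg_subproof (U : Up W) : is_upset (up_neg_set U).
Proof.
apply/asboolP => x y xy hx v yv.
by apply: hx; apply: le_trans yv.
Qed.

Fact up_sim_subproof (U : Up W) : is_upset (up_sim_set U).
Proof.
apply/asboolP => x y xy hx v yv.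
by apply: hx; apply: compat_down yv.
Qed.

Definition up_neg (U : Up W) : Up W := MkUp (up_neg_subproof U).
Definition up_sim (U : Up W) : Up W := MkUp (up_sim_subproof U).

End ComplexAlgebra.

Section ComplexKim.
Context {d : Order.disp_t} (W : subCompatFrameType d).
Implicit Types U V Z : Up W.

Fact up_neg_intuitionistic : intuitionistic_negation (@up_neg d W).
Proof.
split; first split; first split.
- by move=> U V /Up_leP UV; apply/Up_leP => w hw v wv Uv; apply: hw wv (UV _ Uv).
- move=> U V; apply/Up_leP; rewrite Up_setI => w [hU hV] v wv.
  by rewrite Up_setU => -[]; [apply: hU | apply: hV].
- by apply/eqP; rewrite -le1x; apply/Up_leP => w _ v _; rewrite Up_set0.
- move=> U; apply/Up_leP => w Uw v wv; apply; first exact: lexx.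
  exact: (@UpP _ _ U) wv Uw.
- move=> U V Z /Up_leP; rewrite Up_setI => UVZ.
  apply/Up_leP; rewrite Up_setI => w [Uw nZw] v wv Vv.
  by apply: (nZw v wv); apply: UVZ; split=> //; apply: (@UpP _ _ U) wv Uw.
- move=> U V; apply/Up_leP; rewrite Up_setI => w [Uw nUw].
  by case: (nUw w (lexx w)).
Qed.

Fact up_sim_minimal : minimal_negation (@up_sim d W).
Proof.
split; first split.
- by move=> U V /Up_leP UV; apply/Up_leP => w hw v wv Uv; apply: hw wv (UV _ Uv).
- move=> U V; apply/Up_leP; rewrite Up_setI => w [hU hV] v wv.
  by rewrite Up_setU => -[]; [apply: hU | apply: hV].
- by apply/eqP; rewrite -le1x; apply/Up_leP => w _ v _; rewrite Up_set0.
- move=> U; apply/Up_leP => w Uw v wv hv; apply: (hv w _ Uw).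
  exact: compat_sym.
- move=> U V Z /Up_leP; rewrite Up_setI => UVZ.
  apply/Up_leP; rewrite Up_setI => w [Uw nZw] v wv Vv.
  have [z [wz vz wCz]] := compat_sup _ _ wv.
  apply: (nZw z wCz); apply: UVZ.
  by split; [apply: (@UpP _ _ U) wz Uw | apply: (@UpP _ _ V) vz Vv].
Qed.

Fact up_neg_neg_sim1 : up_neg (up_neg (up_sim \top)) = up_sim \top :> Up W.
Proof.
apply/eqP; rewrite eq_le; apply/andP; split; last first.
  by have [[_ h _] _] := up_neg_intuitionistic; apply: h.
apply/Up_leP => w hw v wv _; apply: (@compat_dense d W w); last by exists v.
move=> y wy; apply: contrapT => hy; apply: (hw y wy) => z yz hz.
by apply: hy; exists z; split=> // -[z' zz']; apply: (hz z' zz'); rewrite Up_setT.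
Qed.

HB.instance Definition _ :=
  isKim.Build set_display (Up W) up_neg_intuitionistic up_sim_minimal
    up_neg_neg_sim1.

End ComplexKim.

Fact up_joinxsim d (W : subCompatIdFrameType d) (U : Up W) :
  U `|` sim U = \top.
Proof.
apply/eqP; rewrite -le1x; apply/Up_leP => w _; rewrite Up_setU.
have [Uw|nUw] := pselect (Up_set U w); first by left.
by right=> v /compat_ge vw Uv; apply: nUw; apply: (@UpP _ _ U) vw Uv.
Qed.

HB.instance Definition _ d (W : subCompatIdFrameType d) :=
  isKimOr.Build set_display (Up W) (@up_joinxsim d W).

(* primeFilters A carries the canonical frame of A: inclusion and
   canonical_compat. *)
Section PrimeFilters.
Context {d : Order.disp_t} (A : tbDistrLatticeType d).
Implicit Types (P : set A) (a b : A).

Definition lattice_filter P : Prop :=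
  [/\ P !=set0,
      forall a b, a <= b -> P a -> P b
    & forall a b, P a -> P b -> P (a `&` b)].

Definition prime_filter P : Prop :=
  [/\ lattice_filter P, P <> setT & forall a b, P (a `|` b) -> P a \/ P b].

Definition is_prime_filter : pred (set A) := fun P => `[< prime_filter P >].

Record primeFilters :=
  MkPrimeFilter { filter_set :> set A; _ : is_prime_filter filter_set }.

HB.instance Definition _ := [isSub for filter_set].
HB.instance Definition _ := [Choice of primeFilters by <:].
HB.instance Definition _ :=
  Order.SubChoice_isSubPOrder.Build set_display (set A) is_prime_filter
    set_display primeFilters.

Lemma primeFilterP (P : primeFilters) : prime_filter P.
Proof. by case: P => P /= /asboolP. Qed.

Lemma filter_leP (P Q : primeFilters) : reflect (P `<=` Q) (P <= Q).
Proof. by exact: (@subsetPset _ (val P) (val Q)). Qed.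

Lemma primeFilter_le (P : primeFilters) a b : a <= b -> filter_set P a -> filter_set P b.
Proof. by have [[_ h _] _ _] := primeFilterP P; apply: h. Qed.

Lemma primeFilterI (P : primeFilters) a b : filter_set P a -> filter_set P b -> filter_set P (a `&` b).
Proof. by have [[_ _ h] _ _] := primeFilterP P; apply: h. Qed.

Lemma primeFilterU (P : primeFilters) a b : filter_set P (a `|` b) -> filter_set P a \/ filter_set P b.
Proof. by have [_ _ h] := primeFilterP P; apply: h. Qed.

Lemma primeFilter1 (P : primeFilters) : filter_set P \top.
Proof.
by have [[[a Pa] h _] _ _] := primeFilterP P; apply: h Pa; apply: lex1.
Qed.

Lemma primeFilter0 (P : primeFilters) : ~ filter_set P \bot.
Proof.
have [[_ h _] PT _] := primeFilterP P => P0; apply: PT.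
by apply/seteqP; split=> // a _; apply: h P0; apply: le0x.
Qed.

Lemma prime_filter_theorem (F I : set A) :
  lattice_filter F -> I \bot ->
  (forall a b, a <= b -> I b -> I a) ->
  (forall a b, I a -> I b -> I (a `|` b)) ->
  (forall a, F a -> ~ I a) ->
  exists P : primeFilters, F `<=` P /\ forall a, filter_set P a -> ~ I a.
Proof.
move=> [[f0 Ff0] Fup FI] I0 Idown IU FnI.
pose R (G : set A) := [/\ forall a b, a <= b -> G a -> G b,
  forall a b, G a -> G b -> G (a `&` b), forall a, G a -> ~ I a
  & forall x, G x -> F `<=` G].
have [|G [[Gup GI GnI GF] Gmax]] := @Zorn_bigcup A R.
  move=> S SR Stot; split.
  - move=> a b ab [X SX Xa]; exists X => //.
    by have [h _ _ _] := SR _ SX; apply: h ab Xa.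
  - move=> a b [X SX Xa] [Y SY Yb].
    have [XY|YX] := Stot _ _ SX SY.
      by exists Y => //; have [_ h _ _] := SR _ SY; apply: h => //; apply: XY.
    by exists X => //; have [_ h _ _] := SR _ SX; apply: h => //; apply: YX.
  - by move=> a [X SX Xa]; have [_ _ h _] := SR _ SX; apply: h.
  - move=> x [X SX Xx] y Fy; exists X => //.
    by have [_ _ _ h] := SR _ SX; apply: (h x).
have FG : F `<=` G.
  have [[x Gx]|nG] := pselect (exists x, G x); first exact: GF Gx.
  exfalso; apply: (Gmax F); last by split=> // x _ y.
  split; first by move=> x Gx; case: nG; exists x.
  by move=> h; apply: nG; exists f0; apply: h.
have Gext a : ~ G a -> exists2 g, G g & I (g `&` a).
  move=> nGa; apply: contrapT => h.
  pose H := [set x | exists2 g, G g & g `&` a <= x].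
  have GH : G `<=` H by move=> g Gg; exists g => //; apply: leIl.
  apply: (Gmax H).
    split=> // HG; apply: nGa; apply: HG.
    by exists f0; [apply: FG | apply: leIr].
  split.
  - by move=> x y xy [g Gg gx]; exists g => //; apply: le_trans xy.
  - move=> x y [g Gg gx] [k Gk ky]; exists (g `&` k); first exact: GI.
    rewrite lexI; apply/andP; split.
      by apply: le_trans gx; apply: leI2 => //; apply: leIl.
    by apply: le_trans ky; apply: leI2 => //; apply: leIr.
  - by move=> x [g Gg gx] Ix; apply: h; exists g => //; apply: Idown Ix.
  - by move=> _ _; apply: subset_trans GH.
have Gprime : prime_filter G.
  split.
  - by split=> //; exists f0; apply: FG.
  - by move=> GT; apply: (GnI \bot) => //; rewrite GT.
  - move=> a b Gab; apply: contrapT => /not_orP[nGa nGb].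
    have [g Gg Iga] := Gext _ nGa; have [k Gk Ikb] := Gext _ nGb.
    apply: (GnI ((g `&` k) `&` (a `|` b))).
      by apply: (GI) => //; apply: (GI).
    rewrite meetUr; apply: IU.
      by apply: Idown Iga; apply: leI2 => //; apply: leIl.
    by apply: Idown Ikb; apply: leI2 => //; apply: leIr.
by exists (MkPrimeFilter (asboolT Gprime)).
Qed.

End PrimeFilters.

Section CanonicalFrame.
Context {d : Order.disp_t} (A : kimType d).
Local Notation X := (primeFilters A).
Implicit Types P Q R : X.

Definition canonical_compat P Q : Prop := forall a : A, filter_set P (sim a) -> ~ filter_set Q a.

Fact canonical_compat_down P P' Q Q' :
  P' <= P -> Q' <= Q -> canonical_compat P Q -> canonical_compat P' Q'.
Proof.
by move=> /filter_leP PP /filter_leP QQ h a /PP Pa /QQ; apply: h.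
Qed.

HB.instance Definition _ :=
  isCompatFrame.Build set_display X canonical_compat_down.

Let sim_anti (a b : A) : a <= b -> sim b <= sim a.
Proof. by have [[h _ _] _ _] := @sim_minimal d A; apply: h. Qed.
Let sim_join (a b : A) : sim a `&` sim b <= sim (a `|` b).
Proof. by have [[_ h _] _ _] := @sim_minimal d A; apply: h. Qed.
Let sim0 : sim (\bot : A) = \top.
Proof. by have [[_ _ h] _ _] := @sim_minimal d A. Qed.

Lemma canonical_compat_ext P (F : set A) : lattice_filter F ->
  (forall a, F a -> ~ filter_set P (sim a)) ->
  exists R, F `<=` R /\ canonical_compat P R.
Proof.
move=> hF FP.
have [||||R [FR RI]] := @prime_filter_theorem d A F [set a | filter_set P (sim a)] hF.
- by rewrite /= sim0; apply: primeFilter1.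
- by move=> a b /sim_anti; apply: primeFilter_le.
- move=> a b Pa Pb; apply: primeFilter_le (sim_join a b) _.
  exact: primeFilterI.
- exact: FP.
by exists R; split=> // a Pa Ra; apply: RI Ra Pa.
Qed.

Fact canonical_compat_sym P Q : canonical_compat P Q -> canonical_compat Q P.
Proof.
move=> PQ a Qa Pa; apply: PQ Qa; apply: primeFilter_le Pa.
by have [_ h _] := @sim_minimal d A; apply: h.
Qed.

Fact canonical_compat_sup P Q : canonical_compat P Q ->
  exists R, [/\ P <= R, Q <= R & canonical_compat P R].
Proof.
move=> PQ.
pose F := [set x : A | exists p q, [/\ filter_set P p, filter_set Q q & p `&` q <= x]].
have [| |R [FR PR]] := @canonical_compat_ext P F.
- split.
  + exists \top, \top, \top; split; [exact: primeFilter1| |exact: lex1].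
    exact: primeFilter1.
  + move=> a b ab [p [q [Pp Qq pq]]]; exists p, q; split=> //.
    exact: le_trans ab.
  + move=> a b [p [q [Pp Qq pqa]]] [p' [q' [Pp' Qq' pqb]]].
    exists (p `&` p'), (q `&` q'); split; [exact: primeFilterI..|].
    by rewrite meetACA; apply: leI2.
- move=> a [p [q [Pp Qq pqa]]] Pa; apply: (PQ q) => //.
  have [_ _ h] := @sim_minimal d A.
  by apply: primeFilter_le (h _ _ _ pqa) _; apply: primeFilterI.
exists R; split=> //; apply/filter_leP => a aP; apply: FR.
  by exists a, \top; split; [|exact: primeFilter1|exact: leIl].
by exists \top, a; split; [exact: primeFilter1| |exact: leIr].
Qed.

Lemma canonical_compat_ex P :
  (exists Q, canonical_compat P Q) <-> ~ filter_set P (sim \top).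
Proof.
split=> [[Q PQ] /PQ|nP]; first by apply; apply: primeFilter1.
have [| |Q [_ PQ]] := @canonical_compat_ext P [set \top]; last by exists Q.
- split; first by exists \top.
    by move=> a b /= ab a1; apply/eqP; rewrite -le1x -a1.
  by move=> a b /= -> ->; rewrite meetxx.
- by move=> a /= ->.
Qed.

Fact canonical_compat_dense P :
  (forall Q, P <= Q ->
     exists R, Q <= R /\ ~ (exists R', canonical_compat R R')) ->
  ~ (exists P', canonical_compat P P').
Proof.
move=> hP /canonical_compat_ex; apply.
have [[[neg_anti neg_join neg0] neg_dneg neg_contra] negE] :=
  @neg_intuitionistic d A.
rewrite -neg_neg_sim1; apply: contrapT => nPs.
set s := sim \top in nPs *.
pose F := [set x : A | exists2 p, filter_set P p & p `&` neg s <= x].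
have [| | | | |Q [FQ _]] := @prime_filter_theorem d A F [set \bot].
- split.
  + by exists \top, \top; [exact: primeFilter1|exact: lex1].
  + by move=> a b ab [p Pp pa]; exists p => //; apply: le_trans ab.
  + move=> a b [p Pp pa] [q Pq qb]; exists (p `&` q).
      exact: primeFilterI.
    rewrite lexI; apply/andP; split.
      by apply: le_trans pa; apply: leI2 => //; apply: leIl.
    by apply: le_trans qb; apply: leI2 => //; apply: leIr.
- by [].
- by move=> a b /= ab b0; apply/eqP; rewrite -lex0 -b0.
- by move=> a b /= -> ->; rewrite joinxx.
- move=> a [p Pp pa] /= a0; apply: nPs; apply: primeFilter_le Pp.
  have := neg_contra (neg s) p \bot; rewrite meetC -{1}a0 => /(_ pa).
  have := neg_contra p (neg s) \bot; rewrite -{1}a0 => /(_ pa).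
  by rewrite neg0 meetx1.
have PQ : P <= Q.
  by apply/filter_leP => a Pa; apply: FQ; exists a => //; apply: leIl.
have Qs : filter_set Q (neg s).
  by apply: FQ; exists \top; [exact: primeFilter1|exact: leIr].
have [R [/filter_leP QR nR]] := hP Q PQ.
have Rs : filter_set R s by apply: contrapT => nRs; apply: nR; apply/canonical_compat_ex.
apply: (@primeFilter0 _ _ R); apply: primeFilter_le (negE s \bot) _.
by apply: primeFilterI => //; apply: QR.
Qed.

HB.instance Definition _ :=
  isSubCompatFrame.Build set_display X canonical_compat_sym
    canonical_compat_sup canonical_compat_dense.

End CanonicalFrame.

Fact canonical_compat_ge d (A : kimOrType d) (P Q : primeFilters A) :
  canonical_compat P Q -> Q <= P.
Proof.
move=> PQ; apply/filter_leP => a Qa.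
have : filter_set P (a `|` sim a) by rewrite joinxsim; apply: primeFilter1.
by case/primeFilterU => // /PQ /(_ Qa).
Qed.

HB.instance Definition _ d (A : kimOrType d) :=
  isSubCompatIdFrame.Build set_display (primeFilters A)
    (@canonical_compat_ge d A).

(* Main.v *)
Require Import Defs.
From HB Require Import structures.
From mathcomp Require Import all_boot all_order.
From mathcomp Require Import boolp classical_sets.

(** Both embeddings are evaluation maps: an element of the algebra goes to the
    set of prime filters containing it, a point of the frame to the prime
    filter of upsets containing it.  In part 1 the prime filter theorem
    separates elements and supplies, when a negation of [a] is not in [P], a
    prime filter witnessing this; in part 2 the principal upsets are enough to
    recover both relations of the frame. *)

Import Order.TTheory.

Section Embeddings.
Set Implicit Arguments.
Unset Strict Implicit.
Unset Printing Implicit Defensive.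
Local Open Scope classical_set_scope.
Local Open Scope order_scope.

Lemma principal_lattice_filter d (A : tbDistrLatticeType d) (a : A) :
  lattice_filter [set x | a <= x].
Proof.
split; first by exists a => /=.
  by move=> x y xy /= /le_trans; apply.
by move=> x y /= ax ay; rewrite lexI ax ay.
Qed.

(** The ideal to avoid is the principal one below [b]: since [F] is closed upwards, it meets this
    ideal only if it contains [b]. *)
Lemma prime_filter_separation d (A : tbDistrLatticeType d) (F : set A) (b : A) :
  lattice_filter F -> ~ F b ->
  exists P : primeFilters A, F `<=` P /\ ~ filter_set P b.
Proof.
move=> hF nFb; have [_ Fup _] := hF.
have [||||P [FP Pb]] := @prime_filter_theorem d A F [set x | x <= b] hF.
- exact: le0x.
- by move=> x y xy /=; apply: le_trans.
- by move=> x y /= xb yb; rewrite leUx xb yb.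
- by move=> x Fx /= xb; apply: nFb; apply: Fup Fx.
by exists P; split=> // /Pb; apply; apply: lexx.
Qed.

(** [F] is the filter generated by [P] and [a]. The hypothesis makes it proper, so it can be
    separated from [\bot]. *)
Lemma prime_filter_extension d (A : tbDistrLatticeType d)
    (P : primeFilters A) (a : A) :
  (forall p, filter_set P p -> ~ (p `&` a <= \bot)) ->
  exists Q : primeFilters A, P <= Q /\ filter_set Q a.
Proof.
move=> Pa; pose F := [set x | exists2 p, filter_set P p & p `&` a <= x].
have hF : lattice_filter F.
  split.
  - by exists \top, \top; [exact: primeFilter1 | exact: lex1].
  - by move=> x y xy [p Pp px]; exists p => //; apply: le_trans xy.
  - move=> x y [p Pp px] [q Pq qy].
    exists (p `&` q); first exact: primeFilterI.
    (* Doubling [a] regroups the meet as [(p & a) & (q & a)]. *)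
    by rewrite -[a]meetxx meetACA; apply: leI2.
have [|Q [FQ _]] := prime_filter_separation (b := \bot) hF.
  by move=> [p /Pa].
exists Q; split.
  by apply/filter_leP => x Px; apply: FQ; exists x => //; apply: leIl.
by apply: FQ; exists \top; [exact: primeFilter1 | exact: leIr].
Qed.

Lemma Up_eqP d (W : porderType d) (U V : Up W) :
  (forall w, Up_set U w <-> Up_set V w) -> U = V.
Proof. by move=> UV; apply: val_inj; apply/seteqP; split=> w /UV. Qed.

Context {d : Order.disp_t} (A : kimType d).
Local Notation X := (primeFilters A).

(** Contraposition at [c = \bot], where [neg \bot = \top]. Hence [neg a] is the pseudocomplement of
    [a]. *)
Lemma intuitionistic_negation_le (p a : A) : p `&` a <= \bot -> p <= neg a.
Proof.
have [[[_ _ neg0] _ neg_contra] _] := @neg_intuitionistic d A.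
by move=> /neg_contra; rewrite neg0 meetx1.
Qed.

(** If [P] omits [neg a], no element of [P] is disjoint from [a], as it would lie below [neg a]; so
    [P] extends to a prime filter containing [a]. *)
Lemma filter_negP (P : X) (a : A) :
  filter_set P (neg a) <-> forall Q : X, P <= Q -> ~ filter_set Q a.
Proof.
split=> [Pna Q /filter_leP PQ Qa|hP].
  have [_ negE] := @neg_intuitionistic d A.
  apply: (@primeFilter0 _ _ Q); apply: primeFilter_le (negE a \bot) _.
  by apply: primeFilterI => //; apply: PQ.
apply: contrapT => nPna.
have [|Q [PQ Qa]] := @prime_filter_extension _ _ P a; last exact: hP PQ Qa.
move=> p Pp /intuitionistic_negation_le pna.
by apply: nPna; apply: primeFilter_le Pp.
Qed.

(** For the converse, the witness extends the principal filter of [a]. That filter avoids every [x]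
    with [sim x] in [P], because [a <= x] gives [sim x <= sim a]. *)
Lemma filter_simP (P : X) (a : A) :
  filter_set P (sim a) <-> forall Q : X, compat P Q -> ~ filter_set Q a.
Proof.
split=> [Psa Q PQ|hP]; first exact: PQ.
apply: contrapT => nPsa; have [[sim_anti _ _] _ _] := @sim_minimal d A.
have [|Q [aQ PQ]] := canonical_compat_ext (P := P) (principal_lattice_filter a).
  by move=> x /sim_anti xa Px; apply: nPsa; apply: primeFilter_le xa Px.
by apply: (hP Q PQ); apply: aQ => /=.
Qed.

Fact filters_containing_subproof (a : A) :
  is_upset [set P : X | filter_set P a].
Proof. by apply/asboolP => P Q /filter_leP PQ /PQ. Qed.

Definition filters_containing (a : A) : Up X :=
  MkUp (filters_containing_subproof a).

Lemma filters_containing_embedding : kim_embedding filters_containing.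
Proof.
split.
- move=> a b; apply/Up_leP/idP => [ab|ab P /=]; last exact: primeFilter_le.
  apply: contrapT => nab.
  have [|P [aP nPb]] :=
    prime_filter_separation (b := b) (principal_lattice_filter a) => //.
  by apply/nPb/ab/aP => /=.
- split; apply: Up_eqP => P; split=> //=.
  + by move=> _; apply: primeFilter1.
  + by move=> /primeFilter0.
- split=> a b; apply: Up_eqP => P; split=> /=.
  + by move=> /primeFilterU.
  + by case; apply: primeFilter_le; [exact: leUl | exact: leUr].
  + by move=> Pab; split; apply: primeFilter_le Pab; [exact: leIl|exact: leIr].
  + by case; apply: primeFilterI.
- by move=> a; apply: Up_eqP => P; apply: filter_negP.
- by move=> a; apply: Up_eqP => P; apply: filter_simP.
Qed.

Context (W : subCompatFrameType d).

Fact principal_upset_subproof (x : W) : is_upset [set y | x <= y].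
Proof. by apply/asboolP => y z yz /= /le_trans; apply. Qed.

Definition principal_upset (x : W) : Up W :=
  MkUp (principal_upset_subproof x).

Fact upsets_containing_subproof (x : W) :
  is_prime_filter [set U : Up W | Up_set U x].
Proof.
apply/asboolP; split=> //; first split=> //.
- by exists \top.
- by move=> U V /Up_leP UV /UV.
(* An improper filter would contain the empty upset, to which [x] does not belong. *)
- move=> /seteqP[_ /(_ (\bot : Up W) Logic.I)] //.
Qed.

Definition upsets_containing (x : W) : primeFilters (Up W) :=
  MkPrimeFilter (upsets_containing_subproof x).

Lemma upsets_containing_embedding : frame_embedding upsets_containing.
Proof.
split=> x y.
  apply/filter_leP/idP => [xy|xy U]; last exact: UpP.
  (* The least upset containing [x] already detects the order. *)
  by apply: (xy (principal_upset x)) => /=.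
split=> [xy U /=|xy]; first exact.
(* If [x] is not compatible with [y], it is compatible with nothing above [y], so it lies in [sim]
   of the principal upset of [y], while [y] lies in that upset. *)
apply: contrapT => nxy; apply: (xy (principal_upset y)) => //=.
by move=> v xv /= yv; apply: nxy; apply: compat_down xv.
Qed.

End Embeddings.

Theorem theorem7p8 (d : Order.disp_t) :
  ((forall A : kimType d,
      exists f : A -> (Up (primeFilters A : subCompatFrameType set_display)
                        : kimType set_display),
        kim_embedding f) /\
   (forall A : kimOrType d,
      exists f : A -> (Up (primeFilters A : subCompatIdFrameType set_display)
                        : kimOrType set_display),
        kim_embedding f)) /\
  ((forall W : subCompatFrameType d,
      exists f : W -> (primeFilters (Up W : kimType set_display)
                        : subCompatFrameType set_display),
        frame_embedding f) /\
   (forall W : subCompatIdFrameType d,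
      exists f : W -> (primeFilters (Up W : kimOrType set_display)
                        : subCompatIdFrameType set_display),
        frame_embedding f)).
Proof.
split; split.
- by move=> A; exists (@filters_containing d A); apply: filters_containing_embedding.
- by move=> A; exists (@filters_containing d A); apply: filters_containing_embedding.
- by move=> W; exists (@upsets_containing d W); apply: upsets_containing_embedding.
- by move=> W; exists (@upsets_containing d W); apply: upsets_containing_embedding.
Qed.
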